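(* Let $n\ge 1$, let $T$ be the torus of invertible diagonal matrices acting on $\mathrm{GL}_n(\mathbb{C})/B$ by left multiplication, let $N\in\mathfrak{gl}_n(\mathbb{C})$ be the regular nilpotent operator with $Ne_1=0$ and $Ne_{i+1}=e_i$ for $1\le i<n$, and let $h$ be any Hessenberg function. Let $w\in S_n$ and $1\le j<k\le n$ with $w^{-1}(j)>w^{-1}(k)$. Then $\overline{O_{w,s_{j,k}w}}\subset\mathrm{Hess}(N,h)$ if and only if all of the following hold: (1) $w^{-1}(i)\le h(w^{-1}(i+1))$ for all $i$ with $1\le i<n$. (2) If $k\ne j+1$, then $w^{-1}(k)\le h(w^{-1}(j+1))$; if $k=j+1$, then $w^{-1}(j+1)\le h(w^{-1}(j))$; and, if $k<n$, also $w^{-1}(j)\le h(w^{-1}(k+1))$. (3) $w^{-1}(k-1)\le h(w^{-1}(k))$ and, if $j\neq 1$, $w^{-1}(j-1)\le h(w^{-1}(k))$.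
   Context: $B\subset \mathrm{GL}_n(\mathbb{C})$ is the subgroup of upper triangular matrices, $\mathrm{GL}_n(\mathbb{C})/B$ is the full flag variety, and $[g]=gB$. $e_1,\dots,e_n$ is the standard basis of $\mathbb{C}^n$. The torus $T=\{\operatorname{diag}(T_1,\dots,T_n):T_i\in\mathbb{C}^*\}\subset B$ acts by $s\cdot[g]=[sg]$. For $g\in\mathrm{GL}_n(\mathbb{C})$, $V_j(g)$ is the span of the first $j$ columns of $g$. A Hessenberg function is a map $h:\{1,\dots,n\}\to\{1,\dots,n\}$ with $j\le h(j)$ for all $1\le j\le n$ and $h(j)\le h(j+1)$ for $1\le j\le n-1$. For $X\in\mathfrak{gl}_n(\mathbb{C})$ the Hessenberg variety is $\mathrm{Hess}(X,h)=\{gB\in \mathrm{GL}_n(\mathbb{C})/B : X V_j(g)\subseteq V_{h(j)}(g)\ \text{for all } j\}$. A permutation $w\in S_n$ is identified with the permutation matrix given by $we_i=e_{w(i)}$. $s_{j,k}$ is the transposition exchanging $j$ and $k$. For $c\in\mathbb{C}^*$, $G_{jk}(c)$ is the matrix with $1$'s on the diagonal, entry $c$ in position $(j,k)$, and $0$ elsewhere. For $w\in S_n$ and $j<k$ with $w^{-1}(j)>w^{-1}(k)$, $O_{w,s_{j,k}w}=\{[G_{jk}(c)w]:c\in\mathbb{C}^*\}$ is the one-dimensional $T$-orbit in $\mathrm{GL}_n(\mathbb{C})/B$ whose closure contains $[w]$ and $[s_{j,k}w]$; the bar denotes closure in $\mathrm{GL}_n(\mathbb{C})/B$. *)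

(* Defs.v *)
From HB Require Import structures.
From mathcomp Require Import all_boot all_order all_algebra all_fingroup.
From mathcomp Require Import all_classical all_reals all_analysis.
From mathcomp Require Import complex.

Set Implicit Arguments.
Unset Strict Implicit.
Unset Printing Implicit Defensive.

Import Order.TTheory GRing.Theory Num.Theory.
Import numFieldNormedType.Exports.

Local Open Scope classical_set_scope.
Local Open Scope ring_scope.
Local Open Scope quotient_scope.

(* The complex numbers over the reals R, typed so that the library topology
   (induced by the modulus) on a numClosedFieldType, and hence the one on
   matrices, is inferred. *)
Definition CC (R : realType) : numClosedFieldType := R[i].

(* GL_n(C); as a set_type it carries the subspace topology of 'M[CC R]_n. *)
Definition GL (R : realType) (n : nat) : set 'M[CC R]_n :=
  [set g | g \in unitmx].

Definition upper_triangular (R : realType) (n : nat) (b : 'M[CC R]_n) : Prop :=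
  forall i k : 'I_n, (k < i)%N -> b i k = 0.

Definition borel_group (R : realType) (n : nat) : set 'M[CC R]_n :=
  [set b | GL b /\ upper_triangular b].

Lemma borel_group1 (R : realType) (n : nat) :
  borel_group (1%:M : 'M[CC R]_n).
Proof.
split; first exact: unitmx1.
by move=> i k ki; rewrite mxE; case: eqP ki => // ->; rewrite ltnn.
Qed.

Lemma borel_groupM (R : realType) (n : nat) (a b : 'M[CC R]_n) :
  borel_group a -> borel_group b -> borel_group (a *m b).
Proof.
move=> [ua ta] [ub tb]; split; first by rewrite /GL /= unitmx_mul ua ub.
move=> i k ki; rewrite mxE big1 // => l _.
case: (ltnP l i) => [/ta ->|il]; first by rewrite mul0r.
by rewrite tb ?mulr0 //; exact: leq_trans il.
Qed.

Lemma borel_groupV (R : realType) (n : nat) (b : 'M[CC R]_n) :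
  borel_group b -> borel_group (invmx b).
Proof.
move=> [ub tb]; split; first by rewrite /GL /= unitmx_inv.
have trigb : is_trig_mx b^T.
  by apply/is_trig_mxP => i k ik; rewrite mxE tb.
have bii i : b i i != 0.
  move: ub; rewrite /GL /= unitmxE -det_tr (det_trig trigb) unitfE.
  by move=> /prodf_neq0 /(_ i isT); rewrite mxE.
suff main m (i k : 'I_n) : (n - i <= m)%N -> (k < i)%N -> invmx b i k = 0.
  by move=> i k; exact: main (leqnn _).
elim: m i k => [|m IHm] i k; first by rewrite leqn0 subn_eq0 leqNgt ltn_ord.
move=> le_m ki; have /matrixP /(_ i k) := mulmxV ub.
rewrite !mxE (bigD1 i) //= big1 ?addr0 => [|l li].
  case: eqP ki => [->|_ _]; first by rewrite ltnn.
  by move=> /eqP; rewrite mulf_eq0 (negbTE (bii i)) => /eqP.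
case: (ltnP l i) => [/tb ->|il]; first by rewrite mul0r.
have lt_il : (i < l)%N by rewrite ltn_neqAle il andbT eq_sym.
rewrite IHm ?mulr0 //; last exact: ltn_trans lt_il.
by rewrite -ltnS (leq_trans _ le_m) // ltn_sub2l.
Qed.

(* g and g' have the same left coset: gB = g'B. *)
Definition same_coset (R : realType) (n : nat) : rel (@GL R n) :=
  fun g g' => `[< exists2 b, borel_group b & \val g' = \val g *m b >].

Lemma same_coset_refl (R : realType) (n : nat) : reflexive (@same_coset R n).
Proof.
by move=> g; apply/asboolP; exists 1%:M; rewrite ?mulmx1 //; exact: borel_group1.
Qed.

Lemma same_coset_sym (R : realType) (n : nat) : symmetric (@same_coset R n).
Proof.
suff sub (g g' : @GL R n) : same_coset g g' -> same_coset g' g.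
  by move=> g g'; apply/idP/idP; exact: sub.
move=> /asboolP[b Bb gb]; apply/asboolP; exists (invmx b).
  exact: borel_groupV.
by rewrite gb mulmxK //; case: Bb.
Qed.

Lemma same_coset_trans (R : realType) (n : nat) : transitive (@same_coset R n).
Proof.
move=> g' g g'' /asboolP[b Bb gb] /asboolP[b' Bb' gb'].
apply/asboolP; exists (b *m b'); first exact: borel_groupM.
by rewrite gb' gb mulmxA.
Qed.

Canonical same_coset_equiv (R : realType) (n : nat) :=
  EquivRel (@same_coset R n) (@same_coset_refl R n) (@same_coset_sym R n)
    (@same_coset_trans R n).

(* GL_n(C)/B with the quotient of the classical topology. *)
Definition flag (R : realType) (n : nat) : topologicalType :=
  quotient_topology {eq_quot @same_coset_equiv R n}.

Definition coset_class (R : realType) (n : nat) (g : @GL R n) : flag R n :=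
  \pi_({eq_quot @same_coset_equiv R n}) g.

Lemma coset_classP (R : realType) (n : nat) (g g' : @GL R n) :
  coset_class g = coset_class g' <->
  exists2 b, borel_group b & \val g' = \val g *m b.
Proof.
split=> [/eqmodP /asboolP //|gg']; by apply/eqmodP/asboolP.
Qed.

(* Indices are 0-based: the ordinal j stands for j + 1, so that this is the
   span of the first j + 1 columns, and likewise the value h j of a Hessenberg
   function on 'I_n stands for h j + 1. *)
Definition col_span (R : realType) (n : nat) (g : 'M[CC R]_n) (j : 'I_n) :
    {vspace 'cV[CC R]_n} :=
  <<[seq col l g | l : 'I_n <- enum 'I_n & (l <= j)%N]>>%VS.

Definition hessenberg_fun (n : nat) (h : 'I_n -> 'I_n) : Prop :=
  (forall j : 'I_n, (j <= h j)%N) /\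
  (forall j j' : 'I_n, j' = j.+1 :> nat -> (h j <= h j')%N).

Definition Hess (R : realType) (n : nat) (X : 'M[CC R]_n) (h : 'I_n -> 'I_n) :
    set (flag R n) :=
  [set coset_class g | g in [set g : @GL R n |
    forall (j : 'I_n) (v : 'cV[CC R]_n),
      v \in col_span (\val g) j -> X *m v \in col_span (\val g) (h j)]].

Definition reg_nilp (R : realType) (n : nat) : 'M[CC R]_n :=
  \matrix_(i, l) (l == i.+1 :> nat)%:R.

(* Column l is e_(w l), i.e. w e_l = e_(w l); this is the transpose of the
   library's perm_mx w. *)
Definition perm_matrix (R : realType) (n : nat) (w : 'S_n) : 'M[CC R]_n :=
  \matrix_(i, l) (i == w l)%:R.

Definition root_mx (R : realType) (n : nat) (j k : 'I_n) (c : CC R) :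
    'M[CC R]_n :=
  1%:M + c *: delta_mx j k.

(* O_(w, s_jk w). *)
Definition curve_orbit (R : realType) (n : nat) (w : 'S_n) (j k : 'I_n) :
    set (flag R n) :=
  [set coset_class g | g in [set g : @GL R n |
    exists2 c : CC R, c != 0 & \val g = root_mx j k c *m perm_matrix R w]].

Definition torus (R : realType) (n : nat) : set 'M[CC R]_n :=
  [set s | exists2 t : 'rV[CC R]_n, (forall i, t 0 i != 0) & s = diag_mx t].

Definition torus_orbit (R : realType) (n : nat) (g : @GL R n) :
    set (flag R n) :=
  [set coset_class g' | g' in [set g' : @GL R n |
    exists2 s, torus s & \val g' = s *m \val g]].

Lemma reg_nilp_first (R : realType) (n : nat) (l : 'I_n) :
  l = 0 :> nat -> reg_nilp R n *m delta_mx l 0 = 0 :> 'cV_n.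
Proof. by move=> l0; rewrite -colE; apply/matrixP => i z; rewrite !mxE l0. Qed.

Lemma reg_nilp_next (R : realType) (n : nat) (i l : 'I_n) :
  l = i.+1 :> nat ->
  reg_nilp R n *m delta_mx l 0 = delta_mx i 0 :> 'cV_n.
Proof.
move=> li; rewrite -colE; apply/matrixP => p z.
by rewrite !mxE li eqSS ord1 eqxx andbT eq_sym.
Qed.

Lemma perm_matrix_basis (R : realType) (n : nat) (w : 'S_n) (i : 'I_n) :
  perm_matrix R w *m delta_mx i 0 = delta_mx (w i) 0 :> 'cV_n.
Proof.
by rewrite -colE; apply/matrixP => p z; rewrite !mxE ord1 eqxx andbT.
Qed.

Lemma perm_matrix_unit (R : realType) (n : nat) (w : 'S_n) :
  perm_matrix R w \in unitmx.
Proof.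
have -> : perm_matrix R w = (perm_mx w)^T.
  by apply/matrixP => i l; rewrite !mxE eq_sym.
by rewrite unitmx_tr unitmx_perm.
Qed.

Lemma root_mx_unit (R : realType) (n : nat) (j k : 'I_n) (c : CC R) :
  j != k -> root_mx j k c \in unitmx.
Proof.
move=> jk; have /mulmx1_unit[] // : root_mx j k c *m root_mx j k (- c) = 1%:M.
rewrite mulmxDl mulmxDr !mul1mx -scalemxAl mulmxDr mulmx1 -scalemxAr.
rewrite mul_delta_mx_cond eq_sym (negbTE jk) mulr0n !scaler0 addr0.
by rewrite scaleNr subrK.
Qed.

(* curve_orbit is the orbit of [G_jk(1) w] under the torus. *)
Lemma curve_orbitE (R : realType) (n : nat) (w : 'S_n) (j k : 'I_n)
    (g : @GL R n) :
  j != k -> \val g = root_mx j k 1 *m perm_matrix R w ->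
  curve_orbit w j k = torus_orbit g.
Proof.
move=> jk gE.
have diagG (t : 'rV[CC R]_n) c : (forall i, t 0 i != 0) ->
    diag_mx t *m root_mx j k c = root_mx j k (t 0 j * c / t 0 k) *m diag_mx t.
  move=> t0; rewrite mulmxDl mulmxDr mul1mx mulmx1; congr (_ + _).
  apply/matrixP => p q; rewrite mul_diag_mx mul_mx_diag !mxE.
  case: eqP => [->|_] /=; last by rewrite !(mulr0, mul0r).
  case: eqP => [->|_] /=; last by rewrite !(mulr0, mul0r).
  by rewrite !mulr1 divfK.
have diagw (t : 'rV[CC R]_n) : diag_mx t *m perm_matrix R w =
    perm_matrix R w *m diag_mx (\row_i t 0 (w i)).
  apply/matrixP => p q; rewrite mul_diag_mx mul_mx_diag !mxE.
  by case: eqP => [->|_]; rewrite ?mulr1 ?mul1r ?mulr0 ?mul0r.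
have diagB (t : 'rV[CC R]_n) : (forall i, t 0 i != 0) ->
    borel_group (diag_mx t).
  move=> t0; split.
    rewrite /GL /= unitmxE det_diag unitfE; apply/prodf_neq0 => i _; exact: t0.
  by move=> p q qp; rewrite !mxE; case: eqP qp => // ->; rewrite ltnn.
apply/seteqP; split=> _ [g1 /= [x hx g1E] <-].
- pose t : 'rV[CC R]_n := \row_i (if i == j then x else 1).
  have t0 i : t 0 i != 0 by rewrite mxE; case: ifP; rewrite ?oner_neq0.
  have g2U : diag_mx t *m \val g \in @GL R n.
    rewrite inE /GL /= gE !unitmx_mul root_mx_unit // perm_matrix_unit.
    by case: (diagB _ t0) => ->.
  exists (SigSub g2U) => /=; first by exists (diag_mx t) => //; exists t.
  apply/esym/coset_classP; exists (diag_mx (\row_i t 0 (w i))).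
    by apply: diagB => i; rewrite mxE.
  rewrite /= gE g1E mulmxA diagG // -!mulmxA diagw.
  by congr (root_mx _ _ _ *m _); rewrite !mxE eqxx eq_sym (negbTE jk) mulr1 divr1.
- case: hx => t t0 xE; rewrite xE gE mulmxA diagG // -mulmxA diagw mulmxA in g1E.
  set c := t 0 j * 1 / t 0 k in g1E.
  have c0 : c != 0 by rewrite !mulf_neq0 ?invr_eq0 ?oner_neq0.
  have g2U : root_mx j k c *m perm_matrix R w \in @GL R n.
    by rewrite inE /GL /= unitmx_mul root_mx_unit // perm_matrix_unit.
  exists (SigSub g2U) => /=; first by exists c.
  apply/coset_classP; exists (diag_mx (\row_i t 0 (w i))) => //.
  by apply: diagB => i; rewrite mxE.
Qed.

(* Main.v *)
Require Import Defs.
From mathcomp Require Import all_boot all_order all_algebra all_fingroup.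
From mathcomp Require Import all_classical all_reals all_analysis.

Local Open Scope classical_set_scope.

(** The closed curve never has to be computed: Hess(N, h) is itself closed, so
it contains the closure of the orbit as soon as it contains the orbit, and this
reduces the theorem to a computation with one matrix.

For every X, the condition X V_l(g) <= V_(h(l))(g) for all l says that
g^-1 X g has zero entries at all positions (a, b) with h(b) < a
([Hess_conj]). It does not depend on the representative of gB, because the
V_l(g) do not ([Hess_coset]). After multiplication by det g the condition
becomes the vanishing of entries of adj(g) X g, which are polynomials in the
entries of g, so it defines a closed subset of GL_n that is a union of cosets;
hence its image in the quotient is closed ([Hess_closed]).

Now let E be the elementary matrix with entry 1 at (j, k) and
G = G_jk(c) = 1 + c E. Since j < k, the products EE and ENE vanish, and
G^-1 N G = N + c (N E - E N) ([reg_nilp_root_mx]): besides the superdiagonal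
of N, this matrix has an entry c at (j - 1, k) and an entry - c at (j, k + 1),
off the superdiagonal and different from each other. Conjugation by w
relabels rows and columns, so for c != 0 the point [G w] is in Hess(N, h) if
and only if w^-1(p) <= h(w^-1(q)) for (p, q) = (i, i + 1), (j, k + 1) and
(j - 1, k), whenever these are defined ([Hess_curve]). This criterion is the
same for all c != 0, hence characterizes the inclusion of the whole orbit
([closure_curve_orbit]).

These are condition (1), the last part of (2) and the last part of (3). The
remaining parts follow from them and from w^-1(k) < w^-1(j): the first part
of (2) because w^-1(k) < w^-1(j) <= h(w^-1(j + 1)), the second because
w^-1(k) < w^-1(j) <= h(w^-1(j)), and the first part of (3) is (1) for
i = k - 1. *)

Section HessenbergClosures.
Set Implicit Arguments.
Unset Strict Implicit.
Unset Printing Implicit Defensive.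
Import Order.TTheory GRing.Theory Num.Theory.
Import numFieldNormedType.Exports.
Local Open Scope ring_scope.

(** * The Hessenberg condition as vanishing of matrix entries *)

Lemma hessenberg_fun_mono (n : nat) (h : 'I_n -> 'I_n) :
  hessenberg_fun h -> forall a b : 'I_n, (a <= b)%N -> (h a <= h b)%N.
Proof.
move=> [_ hS] a b; move: {2}(b - a)%N (erefl (b - a)%N) => d.
elim: d b => [|d IHd] b ba le_ab.
  suff -> : a = b by [].
  by apply/val_inj/eqP; rewrite eqn_leq le_ab -subn_eq0 ba /=.
have b0 : (0 < b)%N by rewrite (leq_trans _ (leq_subr a b)) // ba.
have b'n : (b.-1 < n)%N by rewrite (leq_ltn_trans (leq_pred _) (ltn_ord b)).
have bE : b = (Ordinal b'n).+1 :> nat by rewrite /= prednK.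
have lt_ab : (a < b)%N by rewrite -subn_gt0 ba.
apply: leq_trans (hS (Ordinal b'n) b bE).
apply: IHd => /=; last by rewrite -ltnS prednK.
by rewrite -subn1 subnAC ba subn1.
Qed.

(** Membership in V_j(g) is turned into coordinates: in the basis of the columns
of g the vector v has coordinates g^-1 v. *)
Lemma mem_col_span (R : realType) (n : nat) (g : 'M[CC R]_n) (j : 'I_n)
    (v : 'cV[CC R]_n) : g \in unitmx ->
  v \in col_span g j <->
  forall i : 'I_n, (j < i)%N -> (invmx g *m v) i 0 = 0.
Proof.
move=> ug; split=> [|v0].
  rewrite /col_span; set s := [seq col _ _ | _ <- _ & _] => vs i ji.
  rewrite (coord_span (X := in_tuple s) vs) mulmx_sumr summxE big1 // => l _.
  rewrite -scalemxAr mxE.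
  have /mapP[m] : (in_tuple s)`_l \in s by apply: mem_nth.
  rewrite mem_filter => /andP[mj _] ->.
  rewrite colE mulmxA mulVmx // mul1mx mxE.
  by case: eqP => [im|_]; rewrite ?mulr0 //; rewrite im ltnNge mj in ji.
rewrite -[v](mulKVmx ug); move: (invmx g *m v) v0 => u u0.
have -> : g *m u = \sum_l u l 0 *: col l g.
  apply/matrixP => p q; rewrite mxE summxE; apply: eq_bigr => l _.
  by rewrite !mxE ord1 mulrC.
apply: memv_suml => l _; have [lj|/u0 ->] := leqP l j; last first.
  by rewrite scale0r mem0v.
by apply/memvZ/memv_span/map_f; rewrite mem_filter lj mem_enum.
Qed.

Lemma col_span_borel (R : realType) (n : nat) (g b : 'M[CC R]_n) (j : 'I_n) :
  g \in unitmx -> borel_group b -> col_span (g *m b) j = col_span g j.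
Proof.
move=> ug Bb.
have sub (x y : 'M[CC R]_n) : borel_group y ->
    x \in unitmx -> {subset col_span (x *m y) j <= col_span x j}.
  move=> [uy ty] ux v; rewrite !mem_col_span ?unitmx_mul ?ux //.
  move=> v0 i ji; rewrite -[v](mulKVmx (_ : x *m y \in unitmx)); last first.
    by rewrite unitmx_mul ux.
  rewrite -[x *m y *m _]mulmxA mulKmx // mxE big1 // => l _.
  case: (leqP l j) => [lj|/v0 ->]; last by rewrite mulr0.
  by rewrite ty ?mul0r // (leq_ltn_trans lj).
apply/vspaceP => v; apply/idP/idP; first exact: sub.
case: (Bb) => ub _; rewrite -{1}[g](mulmxK ub) => ?.
by apply: sub (borel_groupV Bb) _ _ _; rewrite ?unitmx_mul ?ug.
Qed.

Lemma GL_unitmx (R : realType) (n : nat) (g : @GL R n) : \val g \in unitmx.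
Proof. by have := valP g; rewrite inE. Qed.

(** Being the image of a set, [Hess] only provides some representative with the
required property; V_j(g) depends on gB alone, so all of them have it. *)
Lemma Hess_coset (R : realType) (n : nat) (X : 'M[CC R]_n) (h : 'I_n -> 'I_n)
    (g : @GL R n) :
  Hess X h (coset_class g) <->
  forall (j : 'I_n) (v : 'cV[CC R]_n),
    v \in col_span (\val g) j -> X *m v \in col_span (\val g) (h j).
Proof.
split=> [[g' /= Hg' /coset_classP[b Bb ->]] j v|Hg]; last by exists g.
have ug' := GL_unitmx g'.
by rewrite !col_span_borel //; exact: Hg'.
Qed.

(** In the basis of the columns of g the operator X has matrix M and V_j(g) is
the span of the first basis vectors. One column of M is tested at a time in one
direction; in the other, column l of M, with l <= j, has zeros below h(l),
hence below h(j) by monotonicity. *)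
Lemma Hess_conj (R : realType) (n : nat) (X M : 'M[CC R]_n) (h : 'I_n -> 'I_n)
    (g : @GL R n) : hessenberg_fun h -> X *m \val g = \val g *m M ->
  Hess X h (coset_class g) <-> forall a b : 'I_n, (h b < a)%N -> M a b = 0.
Proof.
move=> hh XgM; have ug := GL_unitmx g.
have conj (u : 'cV_n) : invmx (\val g) *m (X *m (\val g *m u)) = M *m u.
  by rewrite [X *m _]mulmxA XgM -mulmxA mulKmx.
split=> [/Hess_coset HX a b hba|M0].
  have : X *m (\val g *m delta_mx b 0) \in col_span (\val g) (h b).
    apply: HX; apply/mem_col_span => // i bi.
    by rewrite mulKmx // mxE; case: eqP => // ib; rewrite ib ltnn in bi.
  by move=> /mem_col_span-/(_ ug a hba); rewrite conj -colE mxE.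
apply/Hess_coset => j v /mem_col_span-/(_ ug) v0.
apply/mem_col_span => // i hji; rewrite -[v](mulKVmx ug) conj mxE big1 // => l _.
have [lj|/v0 ->] := leqP l j; last by rewrite mulr0.
by rewrite M0 ?mul0r // (leq_ltn_trans (hessenberg_fun_mono hh lj)).
Qed.

(** * Hessenberg varieties are closed *)

Lemma sum_continuous (K : numFieldType) (T : topologicalType) (I : Type)
    (r : seq I) (F : I -> T -> K) :
  (forall i, continuous (F i)) -> continuous (fun x => \sum_(i <- r) F i x).
Proof.
by move=> cF; apply: continuous_big => // -[x y]; apply: add_continuous.
Qed.

Lemma prod_continuous (K : numFieldType) (T : topologicalType) (I : Type)
    (r : seq I) (F : I -> T -> K) :
  (forall i, continuous (F i)) -> continuous (fun x => \prod_(i <- r) F i x).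
Proof.
move=> cF; apply: continuous_big => // x.
by apply: cvgM; [exact: cvg_fst|exact: cvg_snd].
Qed.

Lemma mul_continuous (K : numFieldType) (T : topologicalType) (f g : T -> K) :
  continuous f -> continuous g -> continuous (fun x => f x * g x).
Proof. by move=> cf cg x; apply: cvgM; [exact: cf|exact: cg]. Qed.

Lemma cofactor_continuous (K : numFieldType) (n : nat) (i j : 'I_n) :
  continuous (fun g : 'M[K]_n => cofactor g i j).
Proof.
apply: mul_continuous; first exact: cst_continuous.
apply: sum_continuous => s.
apply: mul_continuous; first exact: cst_continuous.
apply: prod_continuous => l.
under eq_fun do rewrite !mxE.
exact: coord_continuous.
Qed.

(** The adjugate replaces the inverse so that the function is a polynomial on the
whole space of matrices, not just on GL_n. *)
Lemma adj_conj_continuous (K : numFieldType) (n : nat) (X : 'M[K]_n)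
    (a b : 'I_n) :
  continuous (fun g : 'M[K]_n => (\adj g *m X *m g) a b).
Proof.
under eq_fun do rewrite mxE.
apply: sum_continuous => l; apply: mul_continuous; last exact: coord_continuous.
under eq_fun do rewrite mxE.
apply: sum_continuous => m; apply: mul_continuous; last exact: cst_continuous.
under eq_fun do rewrite mxE.
exact: cofactor_continuous.
Qed.

(** Closedness in the quotient is closedness of the preimage in GL_n, and this
preimage is cut out by the polynomial equations (adj(g) X g)_(a,b) = 0. *)
Lemma Hess_closed (R : realType) (n : nat) (X : 'M[CC R]_n)
    (h : 'I_n -> 'I_n) : hessenberg_fun h -> closed (Hess X h).
Proof.
move=> hh; rewrite -openC.
(* A subset of the quotient is open when its preimage is, by definition. *)
change (open (~` (@coset_class R n @^-1` Hess X h))); rewrite openC.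
have -> : @coset_class R n @^-1` Hess X h =
    \bigcap_(ab in [set ab : 'I_n * 'I_n | (h ab.2 < ab.1)%N])
      [set g : @GL R n | (\adj (\val g) *m X *m \val g) ab.1 ab.2 = 0].
  have adjP (g : @GL R n) : \det (\val g) != 0 /\
      exists2 M, X *m \val g = \val g *m M &
        \adj (\val g) *m X *m \val g = \det (\val g) *: M.
    have ug := GL_unitmx g.
    have detg : \det (\val g) != 0 by rewrite -unitfE -unitmxE.
    split=> //; exists (invmx (\val g) *m X *m \val g).
      by rewrite !mulmxA mulmxV ?mul1mx.
    by rewrite /invmx ug -!scalemxAl scalerA mulfV // scale1r.
  apply/seteqP; split=> g /=.
    have [dg [M XM adjM]] := adjP g.
    by move=> /(Hess_conj hh XM) M0 [a b] /= hba; rewrite adjM mxE M0 ?mulr0.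
  have [dg [M XM adjM]] := adjP g.
  move=> M0; apply/(Hess_conj hh XM) => a b hba.
  have : (\adj (\val g) *m X *m \val g) a b = 0 by exact: (M0 (a, b)).
  by rewrite adjM mxE => /eqP; rewrite mulf_eq0 (negPf dg) => /eqP.
apply: closed_bigI => -[a b] /= _.
apply: (@preimage_closed _ _
  (fun g : @GL R n => (\adj (\val g) *m X *m \val g) a b) [set 0]).
  move=> g _; apply: (@continuous_comp _ _ _ (\val : @GL R n -> 'M[CC R]_n)
    (fun x => (\adj x *m X *m x) a b) g).
    exact: initial_continuous.
  exact: adj_conj_continuous.
exact: accessible_closed_set1 (hausdorff_accessible (@norm_hausdorff _ _)) _.
Qed.

(** * Conjugating the regular nilpotent along the curve *)

Lemma mulmx_delta (S : pzRingType) (m n p : nat) (A : 'M[S]_(m, n))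
    (j : 'I_n) (k : 'I_p) i l :
  (A *m delta_mx j k) i l = A i j *+ (l == k).
Proof.
rewrite mxE (bigD1 j) //= big1 ?addr0 => [|r /negPf rj]; last first.
  by rewrite !mxE rj mulr0.
by rewrite !mxE eqxx mulr_natr.
Qed.

Lemma delta_mulmx (S : pzRingType) (m n p : nat) (A : 'M[S]_(n, p))
    (j : 'I_m) (k : 'I_n) i l :
  (delta_mx j k *m A) i l = A k l *+ (i == j).
Proof.
rewrite mxE (bigD1 k) //= big1 ?addr0 => [|r /negPf rk]; last first.
  by rewrite !mxE rk andbF mul0r.
by rewrite !mxE eqxx andbT mulr_natl.
Qed.

(** With N and E for the two matrices: (1 + c E)(N + c (N E - E N)) expands to
N + c N E plus multiples of E N E and E E N. Both vanish: j != k gives E E = 0,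
and E N E is a multiple of the entry of N at (k, j), which lies below the
diagonal. *)
Lemma reg_nilp_root_mx (R : realType) (n : nat) (j k : 'I_n) (c : CC R) :
  (j < k)%N ->
  reg_nilp R n *m root_mx j k c = root_mx j k c *m
    (reg_nilp R n +
     c *: (reg_nilp R n *m delta_mx j k - delta_mx j k *m reg_nilp R n)).
Proof.
move=> jk; rewrite /root_mx; set N := reg_nilp R n; set E := delta_mx j k.
have EE : E *m E = 0 :> 'M[CC R]_n.
  by rewrite mul_delta_mx_0 // -val_eqE /= gtn_eqF.
have ENE : E *m (N *m E) = 0.
  apply/matrixP => a b; rewrite mulmxA mulmx_delta delta_mulmx !mxE.
  by rewrite ltn_eqF ?mul0rn // ltnS ltnW.
rewrite mulmxDl mul1mx mulmxDr mulmx1 -scalemxAr -scalemxAl mulmxDr.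
rewrite -scalemxAr mulmxBr ENE mulmxA EE mul0mx subr0 scaler0 addr0.
by rewrite scalerBr addrA subrK.
Qed.

Lemma mul_perm_matrix (R : realType) (n : nat) (w : 'S_n) (A : 'M[CC R]_n) :
  A *m perm_matrix R w = perm_matrix R w *m \matrix_(a, b) A (w a) (w b).
Proof.
have -> : perm_matrix R w = perm_mx w^-1%g.
  rewrite -tr_perm_mx; apply/matrixP => i l; by rewrite !mxE eq_sym.
rewrite -row_permE -{1}[w]invgK -col_permE invgK.
by apply/matrixP => i b; rewrite !mxE permKV.
Qed.

(** The entry 1 of N and the entries c and - c of the conjugate sit at distinct
positions, so nothing cancels and each of them gives one inequality. *)
Lemma Hess_curve (R : realType) (n : nat) (h : 'I_n -> 'I_n) (w : 'S_n)
    (j k : 'I_n) (c : CC R) (g : @GL R n) :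
  hessenberg_fun h -> (j < k)%N -> c != 0 ->
  \val g = root_mx j k c *m perm_matrix R w ->
  Hess (reg_nilp R n) h (coset_class g) <->
  [/\ forall i i' : 'I_n, i' = i.+1 :> nat ->
        (w^-1%g i <= h (w^-1%g i'))%N,
      forall k' : 'I_n, k' = k.+1 :> nat ->
        (w^-1%g j <= h (w^-1%g k'))%N
    & forall j' : 'I_n, j = j'.+1 :> nat ->
        (w^-1%g j' <= h (w^-1%g k))%N].
Proof.
move=> hh jk c0 gE; set A := reg_nilp R n +
  c *: (reg_nilp R n *m delta_mx j k - delta_mx j k *m reg_nilp R n).
have AE i l : A i l = (l == i.+1 :> nat)%:R +
    c * (((j == i.+1 :> nat) && (l == k))%:R -
         ((i == j) && (l == k.+1 :> nat))%:R).
  have NE : (reg_nilp R n *m delta_mx j k) i l =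
      ((j == i.+1 :> nat) && (l == k))%:R.
    by rewrite mulmx_delta mxE -mulrnA mulnb.
  have EN : (delta_mx j k *m reg_nilp R n) i l =
      ((i == j) && (l == k.+1 :> nat))%:R.
    by rewrite delta_mulmx mxE -mulrnA mulnb andbC.
  by rewrite -NE -EN !mxE.
have gA : reg_nilp R n *m \val g =
    \val g *m \matrix_(a, b) A (w a) (w b).
  by rewrite gE mulmxA reg_nilp_root_mx // -!mulmxA mul_perm_matrix.
have A0 : Hess (reg_nilp R n) h (coset_class g) <->
    forall i l : 'I_n, A i l != 0 -> (w^-1%g i <= h (w^-1%g l))%N.
  apply: (iff_trans (Hess_conj hh gA)); split=> [M0 i l|Ah a b].
    by apply: contraR; rewrite -ltnNge => /M0; rewrite mxE !permKV => ->.
  rewrite mxE; apply: contraPeq => /Ah.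
  by rewrite !permK leqNgt => /negP.
apply: (iff_trans A0); split=> [Ah|[h1 h2 h3] i l].
  split=> [i i' ii'|k' kk'|j' jj']; apply: Ah; rewrite AE.
  (* On the superdiagonal both correction terms are absent since j < k. *)
  - have -> : (j == i.+1 :> nat) && (i' == k) = false.
      apply/negP => /andP[/eqP ji /eqP ik].
      by rewrite -ik ii' -ji ltnn in jk.
    have -> : (i == j) && (i' == k.+1 :> nat) = false.
      apply/negP => /andP[/eqP ij]; rewrite ii' eqSS => /eqP ik.
      by rewrite -ik ij ltnn in jk.
    by rewrite ii' eqxx subr0 mulr0 addr0 oner_neq0.
  - rewrite kk' !eqxx eqSS gtn_eqF // ltn_eqF //= add0r sub0r mulrN mulr1.
    by rewrite oppr_eq0.
  - by rewrite -jj' !eqxx gtn_eqF // (ltn_eqF (ltnSn k)) andbF add0r subr0 mulr1.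
rewrite AE; case: (_ =P i.+1) => [il _|_]; first exact: h1.
case: andP => [[/eqP ji /eqP ->] _|_]; first exact: h3.
case: andP => [[/eqP -> /eqP lk] _|_]; first exact: h2.
by rewrite subr0 mulr0 addr0 eqxx.
Qed.

(** One point of the orbit, for instance c = 1, already forces the inequalities,
and they put every point of the orbit in the closed set [Hess]. *)
Lemma closure_curve_orbit (R : realType) (n : nat) (h : 'I_n -> 'I_n)
    (w : 'S_n) (j k : 'I_n) : hessenberg_fun h -> (j < k)%N ->
  closure (@curve_orbit R n w j k) `<=` Hess (reg_nilp R n) h <->
  [/\ forall i i' : 'I_n, i' = i.+1 :> nat ->
        (w^-1%g i <= h (w^-1%g i'))%N,
      forall k' : 'I_n, k' = k.+1 :> nat ->
        (w^-1%g j <= h (w^-1%g k'))%N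
    & forall j' : 'I_n, j = j'.+1 :> nat ->
        (w^-1%g j' <= h (w^-1%g k))%N].
Proof.
move=> hh jk; split=> [sub|H].
  have jNk : j != k by rewrite -val_eqE /= ltn_eqF.
  have gU (c : CC R) : root_mx j k c *m perm_matrix R w \in @GL R n.
    suff: root_mx j k c *m perm_matrix R w \in unitmx by rewrite inE.
    by rewrite unitmx_mul root_mx_unit // perm_matrix_unit.
  apply/(Hess_curve (g := SigSub (gU 1)) hh jk (oner_neq0 _) erefl)/sub.
  apply: subset_closure; exists (SigSub (gU 1)) => //.
  by exists 1; first exact: oner_neq0.
move=> x cx; apply: (Hess_closed hh); move: x cx.
apply: closureS => _ [g [c c0 gE] <-].
exact/(Hess_curve hh jk c0 gE).
Qed.

End HessenbergClosures.

Theorem theorem4p1 (R : realType) (n : nat) (hn : 1 <= n)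
    (h : 'I_n -> 'I_n) (hh : hessenberg_fun h)
    (w : 'S_n) (j k : 'I_n) (hjk : j < k)
    (hw : (w^-1)%g k < (w^-1)%g j) :
  closure (@curve_orbit R n w j k) `<=` Hess (reg_nilp R n) h
  <->
  [/\ (* (1) *)
      forall i i' : 'I_n, i' = i.+1 :> nat ->
        (w^-1)%g i <= h ((w^-1)%g i'),
      (* (2) *)
      [/\ forall j' : 'I_n, j' = j.+1 :> nat -> k <> j.+1 :> nat ->
            (w^-1)%g k <= h ((w^-1)%g j'),
          forall j' : 'I_n, j' = j.+1 :> nat -> k = j.+1 :> nat ->
            (w^-1)%g j' <= h ((w^-1)%g j)
        & forall k' : 'I_n, k' = k.+1 :> nat ->
            (w^-1)%g j <= h ((w^-1)%g k')]
    & (* (3) *)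
      (forall k' : 'I_n, k = k'.+1 :> nat ->
         (w^-1)%g k' <= h ((w^-1)%g k)) /\
      (forall j' : 'I_n, j = j'.+1 :> nat ->
         (w^-1)%g j' <= h ((w^-1)%g k))].
Proof.
apply: (iff_trans (@closure_curve_orbit R n h w j k hh hjk)).
split=> [[h1 h2 h3]|[h1 [_ _ h2] [_ h3]]]; last by split.
split=> //; split=> //.
- by move=> j' jj' _; apply: leq_trans (ltnW hw) (h1 _ _ jj').
- move=> j' jj' kj; have -> : j' = k by apply/val_inj; rewrite /= jj' kj.
  by apply: leq_trans (ltnW hw) _; case: hh.
- by move=> k' kk'; apply: h1.
Qed.
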